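(* Let $\mathfrak{R}$ be a Rota--Baxter operator on a Clifford semigroup $(S,+)$, let $S_{\mathfrak{R}}=(S,+,\circ)$ be the dual weak brace with $a\circ b:=a+\mathfrak{R}(a)+b-\mathfrak{R}(a)$ for all $a,b\in S$, and let $I\subseteq S$. Then $I$ is an ideal of $S_{\mathfrak{R}}$ if and only if $I$ is a normal subset of both Clifford semigroups $(S,+)$ and $(S,\circ)$.
   Context: A Clifford semigroup is an inverse semigroup with central idempotents. In additive notation (not assumed commutative), $-a$ is the inverse of $a$, $a-b:=a+(-b)$, and $a^0:=a-a=-a+a$. A Rota--Baxter operator on a Clifford semigroup $(S,+)$ is a map $\mathfrak{R}:S\to S$ such that, for all $a,b\in S$, $\mathfrak{R}(a)+\mathfrak{R}(b)=\mathfrak{R}(a+\mathfrak{R}(a)+b-\mathfrak{R}(a))$ and $a+\mathfrak{R}(a)^0=a$. A weak brace is a triple $(S,+,\circ)$ such that $(S,+)$ and $(S,\circ)$ are inverse semigroups and, for all $a,b,c\in S$, $a\circ(b+c)=a\circ b-a+a\circ c$ and $a\circ a^-=-a+a$, where $-a$ and $a^-$ are the inverses of $a$ in $(S,+)$ and $(S,\circ)$ respectively. It is a dual weak brace if $(S,\circ)$ is a Clifford semigroup; then $(S,+)$ is a Clifford semigroup too. For every Rota--Baxter operator $\mathfrak{R}$ on $(S,+)$, $S_{\mathfrak{R}}$ is a dual weak brace. For $a,b\in S$, $\lambda_a(b):=-a+a\circ b$. A subset $N$ of a Clifford semigroup $S$ (written multiplicatively, with $a^0=aa^{-1}=a^{-1}a$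 and $E(S)$ the set of idempotents) is normal if: (1) $E(S)\subseteq N$; (2) $a\in N\Rightarrow a^{-1}\in N$; (3) $a,\ a^0b\in N\Rightarrow ab\in N$; (4) $ab\in N\Rightarrow ba\in N$, for all $a,b\in S$. An ideal of a dual weak brace $(S,+,\circ)$ is a subset $I\subseteq S$ such that $I$ is a normal subset of $(S,+)$, $\lambda_a(I)\subseteq I$ for every $a\in S$, and $I$ is a normal subset of $(S,\circ)$. *)

(* Defs.v *)
From mathcomp Require Import ssreflect ssrfun ssrbool.
From mathcomp Require Import classical_sets.
Set Implicit Arguments.
Unset Strict Implicit.
Unset Printing Implicit Defensive.
Local Open Scope classical_set_scope.

(* The structures below are records over a fixed carrier
   rather than canonical structures, because a brace carries two structures of
   the same kind on one type. *)

Record inverseSemigroup (S : Type) := InverseSemigroup {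
  op : S -> S -> S;
  inv : S -> S;
  op_assoc : associative op;
  invP : forall a b : S,
    (op (op a b) a = a /\ op (op b a) b = b) <-> b = inv a }.

Definition idempotents (S : Type) (A : inverseSemigroup S) : set S :=
  [set e | op A e e = e].

Definition central_idempotents (S : Type) (A : inverseSemigroup S) : Prop :=
  forall e x : S, idempotents A e -> op A e x = op A x e.

Record cliffordSemigroup (S : Type) := CliffordSemigroup {
  clifford_inverse :> inverseSemigroup S;
  clifford_central : central_idempotents clifford_inverse }.

(* a^0 = a a^-1, which equals a^-1 a by [cliff_idl] below *)
Definition idem_of (S : Type) (A : cliffordSemigroup S) (a : S) : S :=
  op A a (inv A a).

Record normal_subset (S : Type) (A : cliffordSemigroup S) (N : set S) : Prop :=
  NormalSubset {
    normal_idem : idempotents A `<=` N;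
    normal_inv : forall a, N a -> N (inv A a);
    normal_op : forall a b, N a -> N (op A (idem_of A a) b) -> N (op A a b);
    normal_comm : forall a b, N (op A a b) -> N (op A b a) }.

Record rota_baxter (S : Type) (A : cliffordSemigroup S) (R : S -> S) : Prop :=
  RotaBaxter {
    rb_add : forall a b,
      op A (R a) (R b) =
      R (op A (op A (op A a (R a)) b) (inv A (R a)));
    rb_idem : forall a, op A a (idem_of A (R a)) = a }.

Record weakBrace (S : Type) := WeakBrace {
  wb_add : inverseSemigroup S;
  wb_mul : inverseSemigroup S;
  wb_distr : forall a b c,
    op wb_mul a (op wb_add b c) =
    op wb_add (op wb_add (op wb_mul a b) (inv wb_add a)) (op wb_mul a c);
  wb_idem : forall a,
    op wb_mul a (inv wb_mul a) = op wb_add (inv wb_add a) a }.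

Record dualWeakBrace (S : Type) := DualWeakBrace {
  dwb_weak :> weakBrace S;
  dwb_central : central_idempotents (wb_mul dwb_weak) }.

Section InverseSemigroupTheory.
Variables (S : Type) (A : inverseSemigroup S).
Local Notation "x * y" := (op A x y).
Local Notation "x ^-1" := (inv A x).

Lemma opA (x y z : S) : x * (y * z) = x * y * z.
Proof. exact: op_assoc. Qed.

Lemma opVK (x : S) : x * x^-1 * x = x.
Proof. by case: ((invP A x x^-1).2 erefl). Qed.

Lemma opKV (x : S) : x^-1 * x * x^-1 = x^-1.
Proof. by case: ((invP A x x^-1).2 erefl). Qed.

Lemma inv_uniq (x y : S) : x * y * x = x -> y * x * y = y -> x^-1 = y.
Proof. by move=> h1 h2; apply/esym/invP. Qed.

Lemma invI (x : S) : x^-1^-1 = x.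
Proof. exact: inv_uniq (opKV x) (opVK x). Qed.

Lemma inv_idem (e : S) : e * e = e -> e^-1 = e.
Proof. by move=> h; apply: inv_uniq; rewrite !h. Qed.

Lemma idem_l (x : S) : x * x^-1 * (x * x^-1) = x * x^-1.
Proof. by rewrite opA opVK. Qed.

Lemma idem_r (x : S) : x^-1 * x * (x^-1 * x) = x^-1 * x.
Proof. by rewrite opA opKV. Qed.

Lemma idem_op (e f : S) : e * e = e -> f * f = f -> e * f * (e * f) = e * f.
Proof.
move=> he hf; pose x := inv A (e * f).
have he' w : e * (e * w) = e * w by rewrite opA he.
have hf' w : f * (f * w) = f * w by rewrite opA hf.
have k1 : e * (f * (x * (e * f))) = e * f by have := opVK (e * f); rewrite -!opA.
have k2 : x * (e * (f * x)) = x by have := opKV (e * f); rewrite -!opA.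
have k2' w : x * (e * (f * (x * w))) = x * w by rewrite -[in RHS]k2 -!opA.
have hx : x = f * (x * e).
  by apply: (@inv_uniq (e * f)); rewrite -!opA ?he' ?hf' ?he ?hf ?k1 ?k2'.
have hxx : x * x = x.
  by rewrite {1}hx {2}hx -!opA k2' -hx.
have hi : x = e * f by rewrite -(inv_idem hxx) /x invI.
by rewrite -hi.
Qed.

Lemma idem_comm (e f : S) : e * e = e -> f * f = f -> e * f = f * e.
Proof.
move=> he hf.
have h1 := idem_op he hf; have h2 := idem_op hf he.
have he' w : e * (e * w) = e * w by rewrite opA he.
have hf' w : f * (f * w) = f * w by rewrite opA hf.
rewrite -!opA in h1 h2.
have h3 : inv A (e * f) = e * f by apply: inv_idem; rewrite -!opA.
by rewrite -h3; apply: inv_uniq; rewrite -!opA ?he' ?hf' ?h1 ?h2.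
Qed.

Lemma central_of_idem :
  (forall x, x * inv A x = inv A x * x) -> central_idempotents A.
Proof.
move=> h e b he; rewrite /idempotents /= in he.
have c w : w * w = w -> e * w = w * e by exact: idem_comm.
have hl := c _ (idem_l b).
have hV : inv A (e * b) = inv A b * e.
  apply: inv_uniq.
    by rewrite !opA -[_ * e * e]opA he -[e * b * _]opA hl
               -[_ * e * e]opA he -hl -opA opVK.
  rewrite !opA -[_ * e * e]opA he -[_ * e * b * _]opA -[_ * e * (b * _)]opA hl.
  by rewrite !opA -[_ * e * e]opA he opKV.
have := h (e * b); rewrite hV => E1.
have {}E1 : e * (b * inv A b) = inv A b * (e * b).
  move: E1; rewrite !opA -[e * b * _]opA hl -[_ * e * e]opA he.
  by rewrite -[_ * e * e]opA he -hl.
have E2 : b * (inv A b * (e * b)) = e * b.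
  by rewrite [LHS]opA [LHS]opA -hl -opA opVK.
by rewrite -E2 -E1 hl h opA [b * (_ * b)]opA opVK.
Qed.

End InverseSemigroupTheory.


Lemma inverse_of_regular (S : Type) (m : S -> S -> S) (i : S -> S) :
    associative m ->
    (forall a, m (m a (i a)) a = a) ->
    (forall a, m (m (i a) a) (i a) = i a) ->
    (forall e f, m e e = e -> m f f = f -> m e f = m f e) ->
  forall a b, (m (m a b) a = a /\ m (m b a) b = b) <-> b = i a.
Proof.
move=> mA h1 h2 hc a b; split; last by move=> ->.
move=> [k1 k2].
have e1 : m (m b a) (m b a) = m b a by rewrite mA k2.
have e2 : m (m (i a) a) (m (i a) a) = m (i a) a by rewrite mA h2.
have e3 : m (m a b) (m a b) = m a b by rewrite mA k1.
have e4 : m (m a (i a)) (m a (i a)) = m a (i a) by rewrite mA h1.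
have f1 : m b a = m (i a) a.
  transitivity (m (m b a) (m (i a) a)).
    by rewrite -mA [m a (m _ a)]mA h1.
  by rewrite (hc _ _ e1 e2) -mA [m a (m _ a)]mA k1.
have f2 : m a b = m a (i a).
  transitivity (m (m a (i a)) (m a b)); first by rewrite mA h1.
  by rewrite (hc _ _ e4 e3) mA k1.
by rewrite -k2 f1 -mA f2 mA h2.
Qed.

Section WeakBraceTheory.
Variables (S : Type) (B : weakBrace S).
Local Notation "x + y" := (op (wb_add B) x y).
Local Notation "x * y" := (op (wb_mul B) x y).
Local Notation "- x" := (inv (wb_add B) x).

Lemma wb_idem_mul (e : S) : e + e = e -> e * e = e.
Proof.
move=> he; have := wb_idem B e; rewrite (inv_idem he) he => h.
by rewrite -[in LHS]h idem_l h.
Qed.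

Lemma wb_idem_add (e : S) : e * e = e -> e + e = e.
Proof.
move=> he; have := wb_idem B e; rewrite (inv_idem he) he => ->.
exact: idem_r.
Qed.

Lemma wb_idem_op (e f : S) : e + e = e -> f + f = f -> e * f = e + f.
Proof.
move=> he hf.
have he' := wb_idem_mul he; have hf' := wb_idem_mul hf.
have hcm := idem_comm he' hf'.
have hh : e * f + e * f = e * f by apply/wb_idem_add/idem_op.
have hce := idem_comm hh he; have hcf := idem_comm hh hf.
have h1 : e * f + e = e * f.
  have := wb_distr B e f f; rewrite hf (inv_idem he) -opA -hce opA hh.
  by move/esym.
have h2 : e * f + f = e * f.
  have := wb_distr B f e e; rewrite he (inv_idem hf) -hcm -opA -hcf opA hh.
  by move/esym.
have hg := idem_op he hf.
have eg : e * (e + f) = e * f.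
  by rewrite wb_distr he' (inv_idem he) he -hce.
have fg : f * (e + f) = e * f.
  by rewrite wb_distr hf' (inv_idem hf) -hcm h2 h2.
have hg' := wb_idem_mul hg.
rewrite -hg' wb_distr (inv_idem hg).
rewrite -(idem_comm he' hg') -(idem_comm hf' hg') eg fg.
by rewrite !opA h1 h2 hh.
Qed.

Lemma wb_add_commV (b : S) : b + - b = - b + b.
Proof.
have P (c : S) : - c + c + (c + - c) = c + - c.
  have hf := idem_r (wb_add B) c; have hg := idem_l (wb_add B) c.
  have E : (- c + c) * c = c by rewrite -wb_idem opVK.
  have := wb_distr B (- c + c) (c + - c) c.
  rewrite opVK E (inv_idem hf) (wb_idem_op hf hg).
  rewrite -[X in X + c](opA _ _ _ _) -(idem_comm hf hg).
  rewrite [_ + (_ + (c + - c))]opA hf -[_ + c]opA opVK => h.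
  by rewrite opA -h.
have h1 := P b; have := P (- b); rewrite invI => h2.
by rewrite -h1 (idem_comm (idem_r _ b) (idem_l _ b)).
Qed.

Lemma wb_add_central : central_idempotents (wb_add B).
Proof. exact: central_of_idem wb_add_commV. Qed.

End WeakBraceTheory.

(* The additive reduct of any weak brace is a Clifford semigroup. *)
Definition dwb_add (S : Type) (B : dualWeakBrace S) : cliffordSemigroup S :=
  CliffordSemigroup (@wb_add_central S B).

Definition dwb_mul (S : Type) (B : dualWeakBrace S) : cliffordSemigroup S :=
  CliffordSemigroup (@dwb_central S B).

Definition lambda (S : Type) (B : dualWeakBrace S) (a b : S) : S :=
  op (dwb_add B) (inv (dwb_add B) a) (op (dwb_mul B) a b).

Record ideal (S : Type) (B : dualWeakBrace S) (I : set S) : Prop := Ideal {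
  ideal_add : normal_subset (dwb_add B) I;
  ideal_lambda : forall a, lambda B a @` I `<=` I;
  ideal_mul : normal_subset (dwb_mul B) I }.

Section RotaBaxterBrace.
Variables (S : Type) (A : cliffordSemigroup S).
Local Notation "x + y" := (op A x y).
Local Notation "- x" := (inv A x).
Local Notation "x ^0" := (idem_of A x) (at level 2, format "x ^0").

Lemma cliff_central (e x : S) : e + e = e -> e + x = x + e.
Proof. exact: clifford_central. Qed.

Lemma cliff_idl (a : S) : a^0 = - a + a.
Proof.
rewrite /idem_of.
have h1 : (- a + a) + (a + - a) = a + - a.
  by rewrite opA (cliff_central a (idem_r A a)) opA opVK.
have h2 : (a + - a) + (- a + a) = - a + a.
  by rewrite opA (cliff_central (- a) (idem_l A a)) opA opKV.
by rewrite -h1 (cliff_central _ (idem_r A a)) h2.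
Qed.

Lemma idem_idem (a : S) : a^0 + a^0 = a^0.
Proof. exact: idem_l. Qed.

Lemma idem0C (a x : S) : a^0 + x = x + a^0.
Proof. exact/cliff_central/idem_idem. Qed.

Lemma idem0K (a : S) : a^0 + a = a.
Proof. exact: opVK. Qed.

Lemma idem0V (a : S) : a^0 + - a = - a.
Proof. by rewrite cliff_idl opKV. Qed.

Lemma cliff_invD (a b : S) : - (a + b) = - b + - a.
Proof.
apply: inv_uniq; rewrite -!opA.
  rewrite [b + (- b + _)]opA -/(b^0) [- a + (a + b)]opA -cliff_idl.
  rewrite [a^0 + b]idem0C [b^0 + _]opA idem0K -idem0C [a + (_ + _)]opA.
  by rewrite -[a + a^0]idem0C idem0K.
rewrite [b + (- b + _)]opA -/(b^0) [- a + (a + _)]opA -cliff_idl.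
rewrite [b^0 + - a]idem0C [a^0 + _]opA idem0V -idem0C [- b + (_ + _)]opA.
by rewrite -[- b + b^0]idem0C idem0V.
Qed.

Variables (R : S -> S) (hR : rota_baxter A R).

Definition rb_op (a b : S) : S := a + R a + b + - R a.

(* the inverse of a for [rb_op], by [rb_op_invK] and [rb_op_Kinv] *)
Definition rb_inv (a : S) : S := - R a + - a + R a.

Lemma rb_opE (a b : S) : R (rb_op a b) = R a + R b.
Proof. by rewrite (rb_add hR). Qed.

Lemma rb_opA : associative rb_op.
Proof.
move=> a b c; rewrite {1}/rb_op [in RHS]/rb_op rb_opE cliff_invD /rb_op !opA.
rewrite -[_ + - R a + R a]opA -cliff_idl -[_ + (R a)^0]opA.
rewrite -(idem0C (R a) b) !opA -[a + R a + _ + - R a]opA -/((R a)^0).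
by rewrite -[a + R a + (R a)^0]opA -[R a + (R a)^0]idem0C idem0K.
Qed.

Lemma rb_idK (a : S) : a + (R a)^0 = a.
Proof. exact: (rb_idem hR). Qed.

Lemma rb_R_idem (e : S) : e + e = e -> R e + R e = R e.
Proof.
move=> he; rewrite -rb_opE /rb_op -[e + R e + e]opA.
by rewrite -(cliff_central (R e) he) opA he -opA rb_idK.
Qed.

Lemma rb_op_idem (e b : S) : e + e = e -> rb_op e b = e + b.
Proof.
move=> he; have hr := rb_R_idem he.
have h : e + R e = e by rewrite -[RHS]rb_idK /idem_of (inv_idem hr) hr.
by rewrite /rb_op (inv_idem hr) h -opA -(cliff_central b hr) opA h.
Qed.

Lemma rb_op_idem_r (e b : S) : e + e = e -> rb_op b e = b + e.
Proof.
move=> he; rewrite /rb_op -opA (cliff_central _ he) opA.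
by rewrite -[b + R b + _]opA -/((R b)^0) rb_idK.
Qed.

Lemma rb_idem_add (e : S) : rb_op e e = e -> e + e = e.
Proof.
move=> he; have hr : R e + R e = R e by rewrite -rb_opE he.
have h : e + R e = e by rewrite -[RHS]rb_idK /idem_of (inv_idem hr) hr.
by rewrite -{3}he /rb_op (inv_idem hr) h -opA h.
Qed.

Lemma rb_op_inv (a : S) : rb_op a (rb_inv a) = a^0.
Proof.
rewrite /rb_op /rb_inv !opA -[a + R a + - R a]opA -/((R a)^0) rb_idK.
rewrite -[_ + R a + - R a]opA -/((R a)^0) -idem0C opA [_ + a]idem0C.
by rewrite rb_idK.
Qed.

Lemma rb_op_invK (a : S) : rb_op (rb_op a (rb_inv a)) a = a.
Proof. by rewrite rb_op_inv (rb_op_idem _ (idem_idem a)) idem0K. Qed.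

Lemma rb_op_Kinv (a : S) : rb_op (rb_op (rb_inv a) a) (rb_inv a) = rb_inv a.
Proof.
rewrite -rb_opA rb_op_inv (rb_op_idem_r _ (idem_idem a)) /rb_inv.
by rewrite -idem0C !opA idem0C -[- R a + _ + - a]opA idem0V.
Qed.

Lemma rb_central (e x : S) : rb_op e e = e -> rb_op e x = rb_op x e.
Proof.
move=> /rb_idem_add he; rewrite rb_op_idem // rb_op_idem_r //.
exact: cliff_central.
Qed.

Definition rb_inverseSemigroup : inverseSemigroup S :=
  InverseSemigroup rb_opA
    (inverse_of_regular rb_opA rb_op_invK rb_op_Kinv
       (fun e f he _ => rb_central f he)).

Lemma rb_distr (a b c : S) :
  rb_op a (b + c) = rb_op a b + - a + rb_op a c.
Proof.
rewrite /rb_op !opA -[_ + - a + a]opA -cliff_idl -[_ + a^0]idem0C !opA opVK.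
rewrite -[_ + - R a + R a]opA -cliff_idl -[_ + (R a)^0]idem0C !opA.
by rewrite -/((R a)^0) idem0C rb_idK.
Qed.

Lemma rb_wb_idem (a : S) : rb_op a (rb_inv a) = - a + a.
Proof. by rewrite rb_op_inv cliff_idl. Qed.

Definition rb_weakBrace : weakBrace S :=
  @WeakBrace S A rb_inverseSemigroup rb_distr rb_wb_idem.

Definition rb_dualWeakBrace : dualWeakBrace S :=
  @DualWeakBrace S rb_weakBrace rb_central.

End RotaBaxterBrace.

(* Main.v *)
Require Import Defs.
From mathcomp Require Import ssreflect ssrfun ssrbool.
From mathcomp Require Import classical_sets.

(** Additive normality already gives the condition on lambda: a normal subset
    absorbs idempotents (apply (3) to [b] and [e], as [b^0 + e] is idempotent)
    and hence, by (4), conjugation, while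
    [lambda a b = a^0 + (R a + b - R a)]. *)

(** [A] and the additive part of the brace share their inverse semigroup but carry different proofs
    of centrality, which normality never inspects. *)
Lemma normal_subset_congr (S : Type) (A B : cliffordSemigroup S) (N : set S) :
  clifford_inverse A = clifford_inverse B ->
  normal_subset A N -> normal_subset B N.
Proof.
case: A B => [A cA] [B cB] /= eAB; subst B.
by case=> n1 n2 n3 n4; split.
Qed.

Lemma normal_subset_idem_op (S : Type) (A : cliffordSemigroup S) (N : set S)
    (e b : S) :
  normal_subset A N -> op A e e = e -> N b -> N (op A e b).
Proof.
move=> hN he Nb; rewrite cliff_central //.
by apply: (normal_op hN) => //; apply/(normal_idem hN)/idem_op/he/idem_idem.
Qed.

Lemma normal_subset_conj (S : Type) (A : cliffordSemigroup S) (N : set S)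
    (x b : S) :
  normal_subset A N -> N b -> N (op A (op A x b) (inv A x)).
Proof.
(* Cycling [inv A x] to the front leaves the idempotent [- x + x] before [b]. *)
move=> hN Nb; apply: (normal_comm hN); rewrite opA.
exact: normal_subset_idem_op hN (idem_r _ _) Nb.
Qed.

Theorem proposition22 (S : Type) (A : cliffordSemigroup S) (R : S -> S)
    (hR : rota_baxter A R) (I : set S) :
  ideal (rb_dualWeakBrace hR) I <->
  normal_subset A I /\ normal_subset (dwb_mul (rb_dualWeakBrace hR)) I.
Proof.
split=> [[hA _ hM] | [hA hM]].
  by split=> //; apply: normal_subset_congr hA.
split=> //; first exact: normal_subset_congr hA.
move=> a _ [b Ib <-]; rewrite /lambda /= /rb_op.
(* Regroup as [(- a + a) + (R a + b - R a)]: an idempotent plus a conjugate of [b]. *)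
rewrite -[op A (op A a (R a)) b]opA -[op A (op A a _) _]opA opA.
apply: (normal_subset_idem_op _ _ _ _ _ hA (idem_r _ _)).
exact: normal_subset_conj hA Ib.
Qed.
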